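(* Let $w = (w_1, \dots, w_{52})$ be the word in which each of the letters $1, 2, \dots, 13$ appears exactly $4$ times, arranged in weakly increasing order, i.e. $w_j = \lceil j/4 \rceil$ for $1 \le j \le 52$. The number of words $u = (u_1, \dots, u_{52})$ that are rearrangements of $w$ (i.e. each of the letters $1, \dots, 13$ appears exactly $4$ times in $u$) and satisfy $u_j \neq w_j$ for every $j \in \{1, \dots, 52\}$ is exactly $$1493804444499093354916284290188948031229880469556.$$
   Context: This counts the derangements of a standard deck of $52$ cards when suits are ignored: there are $13$ denominations, each occurring $4$ times, and cards of the same denomination are regarded as identical. In general, a derangement of the multiset $1^{a_1} \cdots n^{a_n}$ (with $a_i$ copies of $i$) is an arrangement of the multiset, among the $(a_1+\dots+a_n)!/(a_1!\cdots a_n!)$ distinct arrangements, which at every location differs from the original arrangement $1^{a_1} 2^{a_2}\cdots n^{a_n}$; the number of these is denoted $M(a_1, \dots, a_n)$. The number in the claim is $M(4,4,\dots,4)$ with $4$ repeated $13$ times. *)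

(* Defs.v *)
From mathcomp Require Import all_boot.

Set Implicit Arguments.
Unset Strict Implicit.
Unset Printing Implicit Defensive.

Definition derangement (T : eqType) (n : nat) (w u : n.-tuple T) : bool :=
  perm_eq u w && [forall j : 'I_n, tnth u j != tnth w j].

(* Letters 1, ..., 13 and positions 1, ..., 52 are shifted to start at 0:
   since ceil ((j + 1) / 4) - 1 = j %/ 4, position j carries letter j %/ 4. *)
Definition deck : 52.-tuple 'I_13 := [tuple inord (j %/ 4) | j < 52].

(* No truncation by [inord] occurs. *)
Lemma val_deck (j : 'I_52) : tnth deck j = j %/ 4 :> nat.
Proof. by rewrite tnth_mktuple inordK // ltn_divLR. Qed.

(* Main.v *)
Require Import Defs.
From Stdlib Require Import BinNat BinInt.
From HB Require Import structures.
From mathcomp Require Import all_boot all_algebra.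
From mathcomp Require Import zify ssrZ ring.

Set Implicit Arguments.
Unset Strict Implicit.
Unset Printing Implicit Defensive.

Import GRing.Theory.

(** Counting arrangements [u] of a multiset [s] that differ from a word [ws] at
the first [size ws] positions, one removes the last restriction [w]: among the
arrangements without it, those with [w] in that place are the arrangements of
[s] minus one copy of [w] that avoid the remaining word.  After multiplication
by the product of the factorials of the multiplicities, this recursion and its
initial value [(size s)`!] are those of
[Phi ('X^(size s - size ws) * \prod_x P_x)], where [Phi] is the linear form
[Phi 'X^n = n`!] and [P_x] depends only on the multiplicities of [x] in [ws]
and [s].  For the deck, [P_x] is a rescaled Laguerre polynomial of degree 4,
whence the count is [Phi (P ^+ 13) / 24 ^ 13]. *)

(** * Counting words with forbidden letters *)

Section Words.

Variable T : finType.
Implicit Types (w x : T) (s u v ws : seq T).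

(* [zip] truncates: the letters of [u] beyond [size ws] are unrestricted. *)
Definition avoids ws u := all (fun p => p.2 != p.1) (zip ws u).

Definition avoiding_count ws s := count (avoids ws) (permutations s).

Definition prod_fact s := \prod_x (count_mem x s)`!.

Lemma avoids_rcons ws w u : size ws < size u ->
  avoids (rcons ws w) u = avoids ws u && (nth w u (size ws) != w).
Proof.
rewrite /avoids; elim: ws u => [|y ws IHws] [|x u] //=;
  first by case: u => [|y u]; rewrite andbT.
by move=> /IHws ->; rewrite andbA.
Qed.

Lemma avoids_take ws u : avoids ws u = avoids ws (take (size ws) u).
Proof. by rewrite /avoids; elim: ws u => [|y ws IHws] [|x u] //=; rewrite IHws. Qed.

Lemma avoids_insert ws a b w : size a = size ws ->
  avoids ws (a ++ w :: b) = avoids ws (a ++ b).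
Proof. by move=> eq_a; rewrite avoids_take [in RHS]avoids_take -eq_a !take_size_cat. Qed.

Lemma perm_insert s w a b :
  w \in s -> perm_eq (a ++ w :: b) s = perm_eq (a ++ b) (rem w s).
Proof.
move=> s_w; rewrite (permPr (perm_to_rem s_w)) -(perm_cons w (a ++ b)).
by rewrite -[w :: b]cat1s perm_catCA.
Qed.

(** Deleting the forced letter [w] is a bijection: it sits just after the positions restricted by
    [ws], so those are left alone. Its inverse is [ins] below. *)
Lemma count_forced ws s w : w \in s -> size ws < size s ->
  count (fun u => avoids ws u && (nth w u (size ws) == w)) (permutations s)
    = avoiding_count ws (rem w s).
Proof.
move=> s_w lt_ws; rewrite /avoiding_count -!size_filter.
set k := size ws; pose ins u := take k u ++ w :: drop k u.
have ins_inj : injective ins.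
  move=> u v eq_uv; have eq_len : size u = size v.
    move/(congr1 size): eq_uv; rewrite !size_cat /= !addnS -!size_cat !cat_take_drop.
    by case.
  move/eqP: eq_uv; rewrite eqseq_cat ?size_take_min ?eq_len // eqseq_cons eqxx /=.
  by case/andP=> /eqP eq1 /eqP eq2; rewrite -(cat_take_drop k u) eq1 eq2 cat_take_drop.
rewrite -[RHS](size_map ins); apply: perm_size; apply: uniq_perm.
- by apply: filter_uniq; apply: permutations_uniq.
- by rewrite map_inj_uniq //; apply: filter_uniq; apply: permutations_uniq.
move=> u; rewrite mem_filter mem_permutations; apply/idP/mapP.
  case/andP=> /andP[av /eqP nth_u] perm_u.
  have lt_u : k < size u by rewrite (perm_size perm_u).
  have szt : size (take k u) = k by rewrite size_takel // ltnW.
  have def_u : u = take k u ++ w :: drop k.+1 u.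
    by rewrite -{1}[w]nth_u -drop_nth // cat_take_drop.
  exists (take k u ++ drop k.+1 u); last by rewrite /ins take_size_cat // drop_size_cat.
  by rewrite mem_filter mem_permutations -perm_insert // -(avoids_insert _ w) // -def_u av.
case=> v; rewrite mem_filter mem_permutations => /andP[av perm_v] ->.
have le_v : k <= size v by rewrite (perm_size perm_v) size_rem // -ltnS prednK //; case: (s) s_w.
have szt : size (take k v) = k by rewrite size_takel.
rewrite /ins avoids_insert // perm_insert // cat_take_drop av perm_v.
by rewrite nth_cat szt ltnn subnn eqxx.
Qed.

Lemma avoiding_count_rcons ws s w : size ws < size s ->
  avoiding_count ws s = avoiding_count (rcons ws w) s
    + (w \in s) * avoiding_count ws (rem w s).
Proof.
move=> lt_ws; pose forced := [pred u : seq T | nth w u (size ws) == w].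
have -> : avoiding_count ws s = count (predI (avoids ws) (predC forced)) (permutations s)
    + count (predI (avoids ws) forced) (permutations s).
  rewrite /avoiding_count; elim: (permutations s) => //= u r ->.
  by case: (avoids ws u); case: (_ == w) => /=; lia.
congr (_ + _).
  apply: eq_in_count => u; rewrite mem_permutations => /perm_size sz_u.
  by rewrite avoids_rcons ?sz_u.
case: (boolP (w \in s)) => [s_w | sN_w]; first by rewrite mul1n -count_forced.
apply/eqP; rewrite mul0n -leqn0 leqNgt -has_count; apply/hasPn => u /=.
rewrite mem_permutations => perm_u; rewrite negb_and; apply/orP; right.
apply: contra sN_w => /eqP <-; rewrite -(perm_mem perm_u) mem_nth //.
by rewrite (perm_size perm_u).
Qed.

Lemma prod_fact_rem s w : w \in s ->
  prod_fact s = count_mem w s * prod_fact (rem w s).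
Proof.
move=> s_w; rewrite /prod_fact (bigD1 w) // [in RHS](bigD1 w) //= mulnA; congr (_ * _).
  rewrite count_mem_rem eqxx subn1.
  by case: (count_mem w s) (has_count (pred1 w) s) => [|n]; rewrite ?factS // has_pred1 s_w.
by apply: eq_bigr => x /negPf ne_xw; rewrite count_mem_rem eq_sym ne_xw subn0.
Qed.

Lemma sum_count_mem s : \sum_x count_mem x s = size s.
Proof.
elim: s => [|y s IHs] /=; first by rewrite big1.
rewrite big_split /= IHs (bigD1 y) //= eqxx big1 ?addn0 // => x /negPf.
by rewrite eq_sym => ->.
Qed.

Lemma size_permutations_prod_fact s :
  size (permutations s) * prod_fact s = (size s)`!.
Proof.
have [n] := ubnP (size s); elim: n s => // n IHn s le_s.
case: (posnP (size s)) => [/size0nil -> | s_gt0].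
  by rewrite /prod_fact big1.
rewrite (perm_size (permutationsE s_gt0)) size_allpairs_dep sumnE big_map big_distrl /=.
rewrite -(prednK s_gt0) factS prednK // -[X in X * _]sum_count_mem big_distrl /=.
rewrite [RHS](bigID (mem s)) /= [X in _ + X]big1 ?addn0; last first.
  by move=> x /count_memPn ->.
rewrite big_uniq ?undup_uniq //=.
apply: eq_big => [x | x]; rewrite mem_undup // => s_x.
by rewrite (prod_fact_rem s_x) mulnCA IHn ?size_rem //;
  move: le_s s_gt0; case: (size s) => //= m; rewrite ltnS.
Qed.

End Words.

(** * The linear form sending each power of ['X] to a factorial *)

Section FactorialFunctional.

Local Open Scope ring_scope.

Variable R : comNzRingType.
Implicit Types p q : {poly R}.

(** Over the reals, this is the integral of p(t) exp(-t) over t >= 0. *)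
Definition fact_functional p : R := \sum_(i < size p) p`_i *+ i`!.

Lemma fact_functionalE n p : (size p <= n)%N ->
  fact_functional p = \sum_(i < n) p`_i *+ i`!.
Proof.
move=> le_n; rewrite /fact_functional (big_ord_widen n (fun i => p`_i *+ i`!)) //.
rewrite big_mkcond; apply: eq_bigr => i _; case: ltnP => // le_i.
by rewrite nth_default // mul0rn.
Qed.

Lemma fact_functional_is_additive : zmod_morphism fact_functional.
Proof.
move=> p q; pose n := maxn (size (p - q)) (maxn (size p) (size q)).
rewrite !(@fact_functionalE n) ?leq_max ?leqnn ?orbT // -sumrB.
by apply: eq_bigr => i _; rewrite coefB mulrnBl.
Qed.

HB.instance Definition _ :=
  GRing.isZmodMorphism.Build {poly R} R fact_functional fact_functional_is_additive.

Lemma fact_functionalXn n : fact_functional 'X^n = n`!%:R.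
Proof.
rewrite (@fact_functionalE n.+1) ?size_polyXn // big_ord_recr /= coefXn eqxx.
by rewrite big1 ?add0r // => i _; rewrite coefXn ltn_eqF // mul0rn.
Qed.

(* [\sum_k (-1)^k k! 'C(m, k) 'C(c, k) 'X^(m - k)]; when [c = 0] the junk value
   of [c.-1] is multiplied by 0. *)
Fixpoint block_poly m c : {poly R} :=
  if m is m'.+1 then 'X * block_poly m' c - block_poly m' c.-1 *+ c else 1.

(** Lifting the last restriction frees one position, hence an extra ['X]; removing [w] from [s] as
    well keeps the power of ['X] and lowers the multiplicity of [w] alone. These are the two terms
    in the recursion of [block_poly]. *)
Lemma avoiding_count_fact_functional (T : finType) (ws s : seq T) :
    (size ws <= size s)%N ->
  (avoiding_count ws s * prod_fact s)%:R
    = fact_functional ('X^(size s - size ws)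
        * \prod_x block_poly (count_mem x ws) (count_mem x s)).
Proof.
elim/last_ind: ws s => [|ws w IHws] s.
  rewrite /avoiding_count (@eq_count _ _ predT) => [_|[]//].
  rewrite count_predT size_permutations_prod_fact subn0 big1 ?mulr1 //.
  by rewrite fact_functionalXn.
rewrite size_rcons => lt_ws; have le_ws := ltnW lt_ws.
(* If [w] occurs in [s], the coefficient [count_mem w s] is the ratio of [prod_fact s] to
   [prod_fact (rem w s)]; otherwise it is 0. *)
have -> : (avoiding_count (rcons ws w) s * prod_fact s)%:R =
    (avoiding_count ws s * prod_fact s)%:R
      - (avoiding_count ws (rem w s) * prod_fact (rem w s))%:R *+ count_mem w s :> R.
  rewrite (avoiding_count_rcons w lt_ws) mulnDl natrD -mulrnA.
  case: (boolP (w \in s)) => [s_w | /count_memPn ->]; last by rewrite !mul0n muln0 subr0 addr0.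
  by rewrite mul1n -mulnA [(prod_fact (rem _ _) * _)%N]mulnC -prod_fact_rem // addrK.
have prodD1 (f : T -> {poly R}) : \prod_x f x = f w * \prod_(x | x != w) f x.
  by rewrite (bigD1 w).
rewrite IHws //; case: (boolP (w \in s)) => [s_w | sN_w].
  have sz_rem : size (rem w s) = (size s).-1 by rewrite size_rem.
  rewrite IHws ?sz_rem; last by lia.
  rewrite -raddfMn -raddfB; congr fact_functional.
  have -> : (size s - size ws = (size s - (size ws).+1).+1)%N by lia.
  have -> : ((size s).-1 - size ws = size s - (size ws).+1)%N by lia.
  set n := (size s - _)%N.
  rewrite !prodD1 -!cats1 !count_cat /= eqxx count_mem_rem eqxx addn1 subn1 /=.
  (* The factors at letters other than [w] agree in all three products. *)
  set q := \prod_(i | _) _.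
  rewrite [X in _ - _ * (_ * X) *+ _](_ : _ = q); last first.
    by apply: eq_bigr => x /negPf ne; rewrite count_mem_rem eq_sym ne subn0.
  rewrite [X in _ = _ * (_ * X)](_ : _ = q); last first.
    by apply: eq_bigr => x /negPf ne; rewrite count_cat /= eq_sym ne !addn0.
  by rewrite exprSr mulrBl mulrBr mulrnAl mulrnAr !mulrA.
move/count_memPn: (sN_w) => c0; rewrite c0 mulr0n subr0; congr fact_functional.
have -> : (size s - size ws = (size s - (size ws).+1).+1)%N by lia.
rewrite !prodD1 -!cats1 !count_cat /= eqxx addn1 c0 /= mulr0n subr0.
set q := \prod_(i | _) _.
rewrite [X in _ = _ * (_ * X)](_ : _ = q); last first.
  by apply: eq_bigr => x /negPf ne; rewrite count_cat /= eq_sym ne !addn0.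
by rewrite exprSr !mulrA.
Qed.

End FactorialFunctional.

(** * From tuples to sequences, and the multiplicities of the deck *)

Lemma card_derangement (T : finType) n (w : n.-tuple T) :
  #|[set u : n.-tuple T | derangement w u]| = avoiding_count w w.
Proof.
rewrite /avoiding_count -size_filter cardE -(size_map val); apply: perm_size.
apply: uniq_perm.
- by rewrite map_inj_uniq ?enum_uniq //; apply: val_inj.
- by apply: filter_uniq; apply: permutations_uniq.
have avE (u : n.-tuple T) : avoids w u = [forall j, tnth u j != tnth w j].
  have tnthE j : tnth [tuple of zip w u] j = (tnth w j, tnth u j).
    by rewrite (tnth_nth (tnth w j, tnth u j)) /= nth_zip ?size_tuple // -!tnth_nth.
  by apply/all_tnthP/forallP => av j; move: (av j); rewrite tnthE.
move=> u; rewrite mem_filter mem_permutations; apply/mapP/andP => [[v] | [av perm_u]].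
  by rewrite mem_enum inE /derangement -avE => /andP[? ?] ->.
have sz_u : size u == n by rewrite (perm_size perm_u) size_tuple.
by exists (Tuple sz_u); rewrite // mem_enum inE /derangement -avE perm_u.
Qed.

Lemma count_mem_deck (x : 'I_13) : count_mem x deck = 4.
Proof.
(* Over [nat], the 13 cases are settled by evaluation. *)
have -> : count_mem x deck = count (fun i => i %/ 4 == x) (iota 0 52).
  rewrite -val_enum_ord count_map -[RHS]size_filter.
  rewrite /deck /= count_map size_filter; apply: eq_count => j /=.
  by rewrite -val_eqE /= inordK // ltn_divLR.
by case: x; do 13?case=> //.
Qed.

(** * Evaluating the linear form by iteration on lists *)

Section Moments.

Local Open Scope ring_scope.

Variable R : comNzRingType.

(* Unlike [n`!%:R], this never builds a large unary number. *)
Fixpoint fact_ring n : R := if n is m.+1 then n%:R * fact_ring m else 1.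

Lemma fact_ringE n : fact_ring n = n`!%:R.
Proof. by elim: n => //= n ->; rewrite factS natrM. Qed.

Lemma block_poly44 :
  block_poly R 4 4 = 'X^4 - 'X^3 *+ 16 + 'X^2 *+ 72 - 'X *+ 96 + 24%:R.
Proof. by rewrite /=; ring. Qed.

(* If [r] lists the values of [fact_functional] at ['X^i * q], then
   [moments_step r] lists those at ['X^i * (block_poly 4 4 * q)]. *)
Definition moments_step (r : seq R) : seq R :=
  mkseq (fun i => r`_i.+4 - r`_i.+3 *+ 16 + r`_i.+2 *+ 72 - r`_i.+1 *+ 96 + r`_i *+ 24)
    (size r - 4).

Definition moments b n : seq R := iter b moments_step (mkseq fact_ring n).

(** Each step reads four entries ahead and shortens the list by 4, whence the bound on [i]. *)
Lemma nth_moments b n i : (i + b * 4 < n)%N ->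
  (moments b n)`_i = fact_functional ('X^i * block_poly R 4 4 ^+ b).
Proof.
have sz c : size (moments c n) = (n - c * 4)%N.
  by elim: c => [|c IHc]; rewrite ?size_mkseq /= ?size_mkseq ?IHc; lia.
elim: b i => [|b IHb] i lt_i.
  by rewrite nth_mkseq ?fact_ringE ?mulr1 ?fact_functionalXn //; lia.
rewrite /moments iterS -/(moments b n) nth_mkseq ?sz; last by lia.
rewrite !IHb; try lia.
rewrite -!raddfMn -!(raddfB, raddfD); congr fact_functional.
by rewrite !exprS; move: (_ ^+ b) => q; rewrite block_poly44 !exprS; ring.
Qed.

End Moments.

Lemma card_derangement_deck :
  (#|[set u : 52.-tuple 'I_13 | derangement deck u]|%:R * 24%:R ^+ 13
    = (moments Z 13 53)`_0)%R.
Proof.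
(* Since 53 = 13 * 4 + 1, exactly one entry is left after 13 steps. *)
rewrite (@nth_moments Z 13 53 0 isT) card_derangement -natrX.
have -> : (24 ^ 13)%N = prod_fact deck.
  rewrite /prod_fact (eq_bigr (fun=> 24%N)) => [|x _]; last by rewrite count_mem_deck.
  by rewrite prod_nat_const card_ord.
rewrite -natrM avoiding_count_fact_functional; last exact: leqnn.
rewrite subnn (eq_bigr (fun=> block_poly Z 4 4)) => [|x _]; last by rewrite count_mem_deck.
by rewrite prodr_const card_ord.
Qed.

(** The arithmetic runs on binary integers, and the factor 24 ^ 13 avoids a division. *)
Lemma moments_deck : ((moments Z 13 53)`_0 =
  Z.of_N 1493804444499093354916284290188948031229880469556%num * 24%:R ^+ 13)%R.
Proof. by vm_compute. Qed.

Theorem mainTheorem1 :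
  #|[set u : 52.-tuple 'I_13 | derangement deck u]|
    = nat_of_bin 1493804444499093354916284290188948031229880469556%num.
Proof.
have := card_derangement_deck; rewrite moments_deck.
(* With the numeral replaced by a variable [N], nothing can expand it into a unary number. *)
move: #|_| (BinNums.Npos _) => m N /mulIf eq_mN.
have /eq_mN : (24%:R ^+ 13 != 0 :> Z)%R by [].
by rewrite -(rmorph_nat Z.of_nat m) natn; lia.
Qed.
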